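(* Let $\Gamma$ be a connected graph with $e$ edges. Then $\Gamma$ has three (distinct) $\mathcal{L}$-eigenvalues $0,\theta_1,\theta_2$ if and only if the following three properties hold: (i) $\hat{d}_u=td_u^2-(\theta_1-1)(\theta_2-1)d_u$ for all vertices $u$; (ii) $\hat{\lambda}_{uv}=td_ud_v+2-\theta_1-\theta_2$ for adjacent vertices $u$ and $v$; (iii) $\hat{\mu}_{uv}=td_ud_v$ for (distinct) non-adjacent vertices $u$ and $v$; where $t=\frac{\theta_1\theta_2}{2e}$.
   Context: All graphs are finite, simple and undirected. $d_u$ denotes the valency (degree) of vertex $u$, and $u\sim v$ means adjacency. The normalized Laplacian of a graph is the matrix $\mathcal{L}=[\ell_{uv}]$ indexed by the vertices with $\ell_{uu}=1$ if $d_u\neq 0$, $\ell_{uv}=-1/\sqrt{d_ud_v}$ if $u\sim v$, and $\ell_{uv}=0$ otherwise. Its eigenvalues are called the $\mathcal{L}$-eigenvalues of the graph. The normalized valency of $u$ is $\hat{d}_u=\sum_{v\sim u}\frac{1}{d_v}$. For two distinct vertices $u,v$ the normalized number of common neighbors is $\sum_{w\sim u,\,w\sim v}\frac{1}{d_w}$; it is denoted $\hat{\lambda}_{uv}$ if $u$ and $v$ are adjacent and $\hat{\mu}_{uv}$ if they are not.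
   Formalization: The ''if'' direction is stated only for non-complete graphs: for complete graphs it fails (e.g. K_2 with θ1=2, θ2=5 satisfies (i)–(iii) but has only the L-eigenvalues 0 and 2); the ''only if'' direction covers all connected graphs. *)

(* Defs.v *)
From HB Require Import structures.
From mathcomp Require Import all_boot all_order all_algebra.

Set Implicit Arguments.
Unset Strict Implicit.
Unset Printing Implicit Defensive.

Import Order.TTheory GRing.Theory Num.Theory.
Local Open Scope ring_scope.

Definition simple_graph (V : finType) (adj : rel V) : Prop :=
  symmetric adj /\ irreflexive adj.

(* The empty graph is not regarded as connected. *)
Definition connected_graph (V : finType) (adj : rel V) : Prop :=
  (0 < #|V|)%N /\ forall u v : V, connect adj u v.

(* The graph on a single vertex is complete.  On a complete graph with n >= 2
   vertices, the properties (i)-(iii) below hold for theta1 = n / (n - 1) and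
   any theta2, although the only L-eigenvalues are 0 and n / (n - 1); on a
   single vertex they hold for any theta1, theta2. *)
Definition complete_graph (V : finType) (adj : rel V) : Prop :=
  forall u v : V, u != v -> adj u v.

Definition edges (V : finType) (adj : rel V) : {set {set V}} :=
  [set [set p.1; p.2] | p : V * V & adj p.1 p.2].

Definition valency (V : finType) (adj : rel V) (u : V) : nat :=
  #|[set v | adj u v]|.

(* Rows and columns are indexed by V through enum_val : 'I_#|V| -> V. *)
Definition normalized_laplacian (R : rcfType) (V : finType) (adj : rel V) :
    'M[R]_#|V| :=
  \matrix_(i, j)
    let u := enum_val i in
    let v := enum_val j in
    if u == v then (if valency adj u != 0%N then 1 else 0)
    else if adj u v then
      -1 / Num.sqrt ((valency adj u)%:R * (valency adj v)%:R)
    else 0.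

Definition normalized_valency (R : rcfType) (V : finType) (adj : rel V)
    (u : V) : R :=
  \sum_(v | adj v u) 1 / (valency adj v)%:R.

(* For distinct u and v, this is lambda-hat_uv if u and v are adjacent, and
   mu-hat_uv if they are not. *)
Definition normalized_common_neighbors (R : rcfType) (V : finType)
    (adj : rel V) (u v : V) : R :=
  \sum_(w | adj w u && adj w v) 1 / (valency adj w)%:R.

(* The L-eigenvalues, regardless of multiplicity, are exactly 0, theta1 and
   theta2, and these three are pairwise distinct.  Since the normalized
   Laplacian is symmetric, all its eigenvalues lie in R. *)
Definition has_three_L_eigenvalues (R : rcfType) (V : finType) (adj : rel V)
    (theta1 theta2 : R) : Prop :=
  uniq [:: 0; theta1; theta2] /\
  forall x : R,
    eigenvalue (normalized_laplacian R adj) x = (x \in [:: 0; theta1; theta2]).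

(* Properties (i), (ii) and (iii), in this order. *)
Definition three_eigenvalue_properties (R : rcfType) (V : finType)
    (adj : rel V) (theta1 theta2 : R) : Prop :=
  let d u : R := (valency adj u)%:R in
  let t : R := theta1 * theta2 / (2 * #|edges adj|%:R) in
  [/\ forall u : V,
        normalized_valency R adj u
          = t * d u ^+ 2 - (theta1 - 1) * (theta2 - 1) * d u,
      forall u v : V, adj u v ->
        normalized_common_neighbors R adj u v
          = t * d u * d v + 2 - theta1 - theta2
    & forall u v : V, u != v -> ~~ adj u v ->
        normalized_common_neighbors R adj u v = t * d u * d v].

(* Main.v *)
(* Let L be the normalized Laplacian, s the vector of square roots of the
   valencies and t = theta1 theta2 / (2 e).  Read entrywise, (i)-(iii) say that
   (L - theta1) (L - theta2) = t s^T s.  In a connected graph the kernel of L is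
   spanned by s and |s|^2 = 2 e, so this is equivalent to
   (L - theta1) (L - theta2) L = 0; that equation holds when the eigenvalues are
   0, theta1 and theta2, because the symmetric matrix L is diagonalizable.
   Conversely, if the graph is not complete then (L - a) L != 0 for every a, so
   no factor of the cubic can be dropped and all three eigenvalues occur. *)

Require Import Defs.
From HB Require Import structures.
From mathcomp Require Import all_boot all_order all_algebra.
From mathcomp Require Import complex spectral ring.

Set Implicit Arguments.
Unset Strict Implicit.
Unset Printing Implicit Defensive.

Import Order.TTheory GRing.Theory Num.Theory.
Local Open Scope ring_scope.

(** * Symmetric real matrices and the product over their eigenvalues *)

Lemma eigenvalue_conj_diag (F : fieldType) (n : nat) (P : 'M[F]_n)
    (d : 'rV[F]_n) (i : 'I_n) :
  P \in unitmx -> eigenvalue (invmx P *m diag_mx d *m P) (d 0 i).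
Proof.
move=> unitP; apply/eigenvalueP; exists (row i P).
  by rewrite rowE !mulmxA mulmxK // -(rowE i (diag_mx d)) row_diag_mx -scalemxAl.
apply: contraTneq unitP => rowP0; apply/negP => unitP.
have := mulmxK unitP (delta_mx 0 i : 'rV_n); rewrite -rowE rowP0 mul0mx.
by move=> /rowP/(_ i)/eqP; rewrite !mxE !eqxx eq_sym oner_eq0.
Qed.

Lemma prod_conj_diag (F : fieldType) (n : nat) (P : 'M[F]_n) (d : 'rV[F]_n)
    (rs : seq F) :
  P \in unitmx ->
  \prod_(r <- rs) (invmx P *m diag_mx d *m P - r%:M) =
    invmx P *m diag_mx (\row_i \prod_(r <- rs) (d 0 i - r)) *m P.
Proof.
move=> unitP; elim: rs => [|r rs IHrs].
  have -> : \row_i \prod_(r <- [::]) (d 0 i - r) = const_mx 1.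
    by apply/rowP => i; rewrite !mxE big_nil.
  by rewrite big_nil diag_const_mx mulmx1 mulVmx.
have -> : \row_i \prod_(s <- r :: rs) (d 0 i - s) =
    \row_i ((d - const_mx r) 0 i * (\row_j \prod_(s <- rs) (d 0 j - s)) 0 i).
  by apply/rowP => i; rewrite !mxE big_cons.
rewrite big_cons IHrs -mulmx_diag linearB /= diag_const_mx.
have -> : r%:M = invmx P *m r%:M *m P.
  by rewrite mul_mx_scalar -scalemxAl mulVmx // scalemx1.
rewrite -mulmxBl -mulmxBr /GRing.mul /= !mulmxA mulmxK //.
by rewrite mul_mx_scalar -scalemxAl mulVmx // scalemx1.
Qed.

(** Diagonalization may need the larger field [K]; since [map_mx f] is injective, the product
    already vanishes over [F]. *)
Lemma prod_conj_diag_map_eq0 (F K : fieldType) (f : {rmorphism F -> K})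
    (n : nat) (A : 'M[F]_n) (P : 'M[K]_n) (d : 'rV[K]_n) (rs : seq F) :
  P \in unitmx -> map_mx f A = invmx P *m diag_mx d *m P ->
  (forall i, exists2 r, r \in rs & d 0 i = f r) ->
  \prod_(r <- rs) (A - r%:M) = 0.
Proof.
move=> unitP fA dE; apply: (@map_mx_inj _ _ f).
have -> : map_mx f (\prod_(r <- rs) (A - r%:M)) =
    \prod_(r <- [seq f r | r <- rs]) (map_mx f A - r%:M).
  rewrite big_map; elim: {dE} rs => [|r rs IHrs].
    by rewrite !big_nil map_mx1.
  by rewrite !big_cons map_mxM IHrs map_mxB map_scalar_mx.
rewrite fA prod_conj_diag // map_mx0.
suff -> : \row_i \prod_(r <- [seq f r | r <- rs]) (d 0 i - r) = 0.
  by rewrite linear0 mulmx0 mul0mx.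
apply/rowP => i; rewrite !mxE; have [r rs_r ->] := dE i.
by rewrite big_map (big_rem r) //= subrr mul0r.
Qed.

(** Over [R[i]] the matrix is hermitian, so the spectral theorem diagonalizes it with a real
    diagonal, whose entries are therefore eigenvalues of [A] in [R]. *)
Lemma symmetric_prod_eigenvalues (R : rcfType) (n : nat) (A : 'M[R]_n)
    (rs : seq R) :
  A^T = A -> (forall x, eigenvalue A x -> x \in rs) ->
  \prod_(r <- rs) (A - r%:M) = 0.
Proof.
move=> symA eigA; pose f := real_complex R.
pose B : 'M[R[i]]_n := map_mx f A.
have symB : B \is symmetricmx.
  apply/is_hermitianmxP; rewrite expr0 scale1r map_mx_id //.
  by rewrite /B map_trmx symA.
have realB : B \is a realmx.
  by apply/mxOverP => i j; rewrite mxE; apply/complex_realP; exists (A i j).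
have hermB := realsym_hermsym symB realB.
have /orthomx_spectralP := hermitian_normalmx hermB.
have := hermitian_spectral_diag_real hermB.
have := spectral_unit B.
move: (spectralmx B) (spectral_diag B) => P d unitP /mxOverP real_d Beq.
apply: (prod_conj_diag_map_eq0 unitP Beq) => i.
have /complex_realP[r di] := real_d 0 i; exists r => //.
apply: eigA; rewrite -(eigenvalue_map f).
by have := eigenvalue_conj_diag d i unitP; rewrite -Beq di.
Qed.

(** * Auxiliary facts on sums and matrices *)

Lemma sum_enum_val (R : nmodType) (V : finType) (F : V -> R) :
  \sum_(i < #|V|) F (enum_val i) = \sum_v F v.
Proof. by rewrite (reindex _ (onW_bij _ (@enum_val_bij V))). Qed.

(** By symmetry, each diagonal entry of [M *m M] is the sum of the squares of a row of [M]. *)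
Lemma symmetric_sqr_eq0 (R : realDomainType) (n : nat) (M : 'M[R]_n) :
  M^T = M -> M *m M = 0 -> M = 0.
Proof.
move=> symM sqM; apply/matrixP => i j; rewrite mxE.
have /matrixP/(_ i i) := sqM; rewrite !mxE => sum0.
apply/eqP; rewrite -sqrf_eq0; apply/eqP.
have /psumr_eq0P : \sum_k M i k ^+ 2 = 0.
  by rewrite -[RHS]sum0; apply: eq_bigr => k _; rewrite expr2 -{2}symM mxE.
by apply=> // k _; exact: sqr_ge0.
Qed.

Lemma unitmx_not_eigenvalue (F : fieldType) (n : nat) (A : 'M[F]_n) (a : F) :
  ~~ eigenvalue A a -> A - a%:M \in unitmx.
Proof. by rewrite negbK kermx_eq0 row_free_unit. Qed.

Lemma comm_sub_scalar (F : comNzRingType) (n : nat) (A : 'M[F]_n) (a b : F) :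
  (A - a%:M) *m (A - b%:M) = (A - b%:M) *m (A - a%:M).
Proof.
rewrite !mulmxBl !mulmxBr !mul_scalar_mx !mul_mx_scalar !scale_scalar_mx.
rewrite [b * a]mulrC !opprB !addrA addrAC [RHS]addrAC.
by congr (_ + _); rewrite addrAC.
Qed.

(** * Valencies and edges *)

Section Graph.

Variables (V : finType) (adj : rel V).
Hypotheses (adjC : symmetric adj) (adj_irr : irreflexive adj).

(** Handshake lemma: both sides count the ordered adjacent pairs [D], and the map [e] forgetting the
    order has fibres of size two. *)
Lemma sum_valency : (\sum_u valency adj u = 2 * #|edges adj|)%N.
Proof.
pose D := [set p : V * V | adj p.1 p.2].
pose e (p : V * V) := [set p.1; p.2].
have -> : (\sum_u valency adj u = #|D|)%N.
  rewrite -sum1_card (eq_bigl (fun p => xpredT p.1 && adj p.1 p.2)); last first.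
    by move=> p; rewrite inE.
  rewrite -(pair_big_dep xpredT adj (fun _ _ => 1%N)) /=.
  by apply: eq_bigr => u _; rewrite /valency -sum1dep_card.
have -> : edges adj = e @: D.
  by apply/setP => E; apply/imsetP/imsetP => -[p]; rewrite ?inE => pD ->;
    exists p; rewrite ?inE.
rewrite -sum1_card (partition_big_imset e) /= mulnC -sum_nat_const.
apply: eq_bigr => _ /imsetP[[u v] + ->]; rewrite inE /= => uv.
rewrite sum1dep_card.
have neq_uv : u != v by apply: contraTneq uv => ->; rewrite adj_irr.
have -> : [set p in D | e p == e (u, v)] = [set (u, v); (v, u)].
  apply/setP => -[x y]; rewrite !inE /= !xpair_eqE.
  apply/andP/orP => [[xy /eqP exy]|[/andP[/eqP-> /eqP->]|/andP[/eqP-> /eqP->]]].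
  - have: x \in e (u, v) by rewrite -exy !inE eqxx.
    have: y \in e (u, v) by rewrite -exy !inE eqxx orbT.
    rewrite !inE /= => /orP[]/eqP yE /orP[]/eqP xE; move: xy;
      rewrite xE yE ?adj_irr ?eqxx //; by [left|right].
  - by [].
  - by rewrite adjC /e setUC.
by rewrite cards2 xpair_eqE negb_and neq_uv.
Qed.

(** Without neighbors, [u] would form a connected component by itself. *)
Lemma connected_valency_gt0 (u v : V) :
  connected_graph adj -> u != v -> (0 < valency adj u)%N.
Proof.
move=> [_ conn] neq_uv; rewrite card_gt0; apply: contraNneq neq_uv => noN.
have closed_u : closed adj (pred1 u).
  apply: intro_closed => [|x y + /eqP xu]; first exact: sym_connect_sym.
  by rewrite xu => uy; have := in_set0 y; rewrite -noN inE uy.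
by rewrite eq_sym -[_ == _](closed_connect closed_u (conn u v)) inE eqxx.
Qed.

(** * The normalized Laplacian, its square and its kernel *)

Variable R : rcfType.
Hypothesis valency_gt0 : forall u, (0 < valency adj u)%N.

Local Notation L := (normalized_laplacian R adj).
Local Notation d u := ((valency adj u)%:R : R).
Local Notation s u := (Num.sqrt (d u)).

Definition sqrt_valency : 'rV[R]_#|V| := \row_i s (enum_val i).

Lemma valencyr_gt0 u : 0 < d u. Proof. by rewrite ltr0n. Qed.

Lemma sqrtv_gt0 u : 0 < s u. Proof. by rewrite sqrtr_gt0 valencyr_gt0. Qed.

Lemma sqrtv_neq0 u : s u != 0. Proof. exact: lt0r_neq0 (sqrtv_gt0 u). Qed.

Lemma sqrtv_sqr u : s u * s u = d u.
Proof. by rewrite -expr2 sqr_sqrtr // ltW // valencyr_gt0. Qed.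

Lemma sum_neighbors_const (x : R) v : \sum_(u | adj v u) x = d v * x.
Proof. by rewrite sumr_const mulr_natl /valency cardsE. Qed.

Lemma valency_div_sqrt v : d v / s v = s v.
Proof.
by apply: (mulIf (sqrtv_neq0 v)); rewrite divfK ?sqrtv_neq0 // sqrtv_sqr.
Qed.

(** The adjacency matrix conjugated to D^(-1/2) A D^(-1/2), with D the diagonal matrix of
    valencies. *)
Definition normalized_adjacency : 'M[R]_#|V| :=
  \matrix_(i, j) ((adj (enum_val i) (enum_val j))%:R /
                  (s (enum_val i) * s (enum_val j))).

Local Notation A := normalized_adjacency.

Lemma normalized_laplacianE : L = 1%:M - A.
Proof.
apply/matrixP => i j; rewrite !mxE /= (inj_eq enum_val_inj).
case: eqVneq => [->|neq_ij]; first by rewrite adj_irr mul0r subr0 lt0n_neq0.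
rewrite sqrtrM ?ler0n // sub0r; case: (adj _ _); last by rewrite mul0r oppr0.
by rewrite mulNr.
Qed.

Lemma normalized_laplacian_tr : L^T = L.
Proof.
rewrite normalized_laplacianE linearB /= tr_scalar_mx; congr (_ - _).
by apply/matrixP => i j; rewrite !mxE adjC [s _ * _]mulrC.
Qed.

(** A walk u, w, v contributes 1 / (s u * s w * s w * s v), and [s w * s w] is the valency of w. *)
Lemma normalized_adjacency_sqr i j :
  (A *m A) i j = normalized_common_neighbors R adj (enum_val i) (enum_val j) /
    (s (enum_val i) * s (enum_val j)).
Proof.
set u := enum_val i; set v := enum_val j; rewrite mxE.
pose F w := (adj u w)%:R / (s u * s w) * ((adj w v)%:R / (s w * s v)).
rewrite (eq_bigr (F \o enum_val)) => [|k _]; last by rewrite !mxE.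
rewrite sum_enum_val /normalized_common_neighbors mulr_suml [RHS]big_mkcond.
apply: eq_bigr => w _; rewrite /F (adjC u w).
case: (adj w u); last by rewrite !mul0r.
case: (adj w v); last by rewrite mul0r mulr0.
by rewrite -[in RHS](sqrtv_sqr w) /=; field; rewrite !sqrtv_neq0.
Qed.

Lemma quadratic_laplacian_entry (a b : R) i j :
  let u := enum_val i in let v := enum_val j in
  ((L - a%:M) *m (L - b%:M)) i j =
    (normalized_common_neighbors R adj u v + (a + b - 2) * (adj u v)%:R) /
      (s u * s v) + (a - 1) * (b - 1) * (u == v)%:R.
Proof.
move=> u v; rewrite (inj_eq enum_val_inj).
(* Each factor [L - c] equals (1 - c) - A. *)
have -> : (L - a%:M) *m (L - b%:M) =
    A *m A + (a + b - 2) *: A + ((a - 1) * (b - 1))%:M.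
  rewrite normalized_laplacianE.
  have E c : 1%:M - A - c%:M = (1 - c)%:M - A.
    by rewrite addrAC -raddfB.
  rewrite !E mulmxBl !mulmxBr -scalar_mxM mul_scalar_mx mul_mx_scalar.
  apply/matrixP => k l; rewrite !mxE.
  set x := \sum_(_ < _) _; set y := _ / _; case: (k == l); ring.
rewrite mxE mxE normalized_adjacency_sqr -/u -/v !mxE.
by rewrite -/u -/v -mulr_natr; ring.
Qed.

(** [sqrt_valency] is fixed by the normalized adjacency matrix: each of the [d v] neighbors of v
    contributes 1 / s v, and d v / s v = s v. *)
Lemma sqrt_valency_mul_laplacian : sqrt_valency *m L = 0.
Proof.
rewrite normalized_laplacianE mulmxBr mulmx1; apply/rowP => j; rewrite !mxE.
set v := enum_val j; pose F u := s u * ((adj u v)%:R / (s u * s v)).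
rewrite (eq_bigr (F \o enum_val)) => [|k _]; last by rewrite !mxE.
rewrite sum_enum_val (eq_bigr (fun u => if adj v u then (s v)^-1 else 0)).
  by rewrite -big_mkcond sum_neighbors_const valency_div_sqrt subrr.
move=> u _; rewrite /F adjC; case: (adj v u); last by rewrite mul0r mulr0.
by rewrite /=; field; rewrite !sqrtv_neq0.
Qed.

(* If x L = 0 then u |-> x u / sqrt (d u) is harmonic, hence constant on a
   connected graph by the maximum principle. *)
Lemma laplacian_kernel (x : 'rV[R]_#|V|) :
  connected_graph adj -> x *m L = 0 -> exists c, x = c *: sqrt_valency.
Proof.
move=> [V_gt0 conn] xL0.
pose y u := x 0 (enum_rank u) / s u.
have harmonic v : \sum_(u | adj v u) (y v - y u) = 0.
  have /rowP/(_ (enum_rank v)) := xL0.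
  rewrite normalized_laplacianE mulmxBr mulmx1 !mxE.
  pose F u := x 0 (enum_rank u) * ((adj u v)%:R / (s u * s v)).
  rewrite (eq_bigr (F \o enum_val)) => [|k _]; last first.
    by rewrite !mxE /F /= enum_valK enum_rankK.
  rewrite sum_enum_val => xv.
  have -> : \sum_(u | adj v u) (y v - y u) =
      s v * (x 0 (enum_rank v) - \sum_u F u); last by rewrite xv mulr0.
  rewrite sumrB sum_neighbors_const mulrBr /y mulrCA valency_div_sqrt.
  rewrite [_ * s v]mulrC.
  congr (_ - _); rewrite big_mkcond mulr_sumr; apply: eq_bigr => u _.
  rewrite /F adjC; case: (adj u v); last by rewrite mul0r !mulr0.
  by rewrite /=; field; rewrite !sqrtv_neq0.
have /card_gt0P[u0 _] := V_gt0.
have [m _ max_m] := @arg_maxP _ _ _ u0 xpredT y isT.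
have closed_m : closed adj [pred u | y u == y m].
  apply: intro_closed => [|u v uv]; first exact: sym_connect_sym.
  rewrite !inE => /eqP yu.
  have ge0 w : adj u w -> 0 <= y u - y w.
    by rewrite subr_ge0 yu => _; exact: max_m.
  by have /eqP := psumr_eq0P ge0 (harmonic u) uv; rewrite subr_eq0 eq_sym yu.
exists (y m); apply/rowP => i; rewrite !mxE.
have := closed_connect closed_m (conn m (enum_val i)).
rewrite !inE eqxx => /esym/eqP <-.
by rewrite /y enum_valK divfK // sqrtv_neq0.
Qed.

Lemma sqrt_valency_norm :
  sqrt_valency *m sqrt_valency^T = (2 * #|edges adj|%:R)%:M.
Proof.
apply/matrixP => i j; rewrite !ord1 !mxE eqxx mulr1n.
rewrite (eq_bigr (fun k => d (enum_val k))) => [|k _]; last first.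
  by rewrite !mxE /= sqrtv_sqr.
by rewrite (sum_enum_val (fun u => d u)) -natr_sum sum_valency natrM.
Qed.

Lemma edges_gt0 : connected_graph adj -> 0 < 2 * #|edges adj|%:R :> R.
Proof.
move=> [/card_gt0P[u _] _]; rewrite -natrM -sum_valency ltr0n.
by rewrite (bigD1 u) //= ltn_addr.
Qed.

(** * Properties (i)-(iii) as a quadratic matrix equation *)

Lemma properties_quadratic (a b : R) :
  three_eigenvalue_properties adj a b <->
  (L - a%:M) *m (L - b%:M) =
    (a * b / (2 * #|edges adj|%:R)) *: (sqrt_valency^T *m sqrt_valency).
Proof.
rewrite /three_eigenvalue_properties; set t := a * b / _.
have rhsE i j : (t *: (sqrt_valency^T *m sqrt_valency)) i j =
    t * (s (enum_val i) * s (enum_val j)).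
  by rewrite !mxE big_ord1 !mxE.
(* Clearing the denominator [s u * s v] turns the square roots on the right into valencies. *)
have entryE u v x : x / (s u * s v) = t * (s u * s v) <-> x = t * d u * d v.
  have -> : t * d u * d v = t * (s u * s v) * (s u * s v).
    by rewrite -[RHS]mulrA (mulrACA (s u)) !sqrtv_sqr mulrA.
  have s2_neq0 : s u * s v != 0 by rewrite mulf_neq0 ?sqrtv_neq0.
  by split=> [<-|->]; rewrite ?divfK ?mulfK.
have diagE u : normalized_common_neighbors R adj u u = normalized_valency R adj u.
  by apply: eq_bigl => w; rewrite andbb.
split=> [[valE adjE nadjE]|quadE].
  apply/matrixP => i j; rewrite rhsE quadratic_laplacian_entry.
  move: (enum_val i) (enum_val j) => u v.
  case: eqVneq => [<-|neq_uv].
    rewrite diagE valE adj_irr mulr0 addr0 mulr1 sqrtv_sqr.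
    by field; rewrite lt0r_neq0 ?valencyr_gt0.
  rewrite mulr0 addr0; apply/entryE; case: (boolP (adj u v)) => uv.
    by rewrite adjE //=; ring.
  by rewrite nadjE //=; ring.
have entry u v : (normalized_common_neighbors R adj u v +
    (a + b - 2) * (adj u v)%:R) / (s u * s v) + (a - 1) * (b - 1) * (u == v)%:R
    = t * (s u * s v).
  have /matrixP/(_ (enum_rank u) (enum_rank v)) := quadE.
  by rewrite rhsE quadratic_laplacian_entry !enum_rankK.
split=> [u|u v uv|u v neq_uv nuv]; have := entry u _.
- move/(_ u); rewrite diagE adj_irr eqxx mulr0 addr0 mulr1 sqrtv_sqr => diag.
  have d_neq0 := lt0r_neq0 (valencyr_gt0 u).
  (* The left side is put in the form (x / d u + (a - 1)(b - 1) - (a - 1)(b - 1)) * d u, so that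
     [diag] applies. *)
  by rewrite -[LHS](divfK d_neq0) -(addrK ((a - 1) * (b - 1)) (_ / _)) diag; ring.
- move/(_ v); have neq_uv : u != v by apply: contraTneq uv => ->; rewrite adj_irr.
  rewrite uv (negPf neq_uv) mulr0 addr0 mulr1 => /entryE <-; ring.
- move/(_ v); rewrite (negPf nuv) (negPf neq_uv) !mulr0 !addr0.
  by move/entryE.
Qed.

(** Every row of [M] lies in the kernel of L, so [M] is [C^T *m sqrt_valency]; evaluating
    [sqrt_valency *m M] in two ways, once through the symmetry of [M], determines [C]. *)
Lemma three_eigenvalues_quadratic (a b : R) :
  connected_graph adj -> (L - a%:M) *m (L - b%:M) *m L = 0 ->
  (L - a%:M) *m (L - b%:M) =
    (a * b / (2 * #|edges adj|%:R)) *: (sqrt_valency^T *m sqrt_valency).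
Proof.
move=> conn; set M := _ *m (L - _) => ML0.
have symM : M^T = M.
  have symL c : (L - c%:M)^T = L - c%:M.
    by rewrite linearB /= tr_scalar_mx normalized_laplacian_tr.
  by rewrite /M trmx_mul !symL comm_sub_scalar.
have /fin_all_exists[c rowM] i : exists c, row i M = c *: sqrt_valency.
  by apply: laplacian_kernel => //; rewrite -row_mul ML0 row0.
pose C : 'rV[R]_#|V| := \row_i c i.
have ME : M = C^T *m sqrt_valency.
  apply/row_matrixP => i; rewrite rowM row_mul; apply/rowP => j.
  by rewrite !mxE big_ord1 !mxE.
(* On [sqrt_valency] the factors act as - a and - b. *)
have sM : sqrt_valency *m M = (a * b) *: sqrt_valency.
  have sL c' : sqrt_valency *m (L - c'%:M) = - c' *: sqrt_valency.
    by rewrite mulmxBr sqrt_valency_mul_laplacian sub0r mul_mx_scalar scaleNr.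
  by rewrite /M mulmxA sL -scalemxAl sL scalerA mulrNN.
have e_neq0 := lt0r_neq0 (edges_gt0 conn).
have CE : C = (a * b / (2 * #|edges adj|%:R)) *: sqrt_valency.
  apply: (scalerI e_neq0); rewrite scalerA [_ * (_ / _)]mulrC divfK //.
  rewrite -sM -symM ME.
  by rewrite trmx_mul trmxK mulmxA sqrt_valency_norm mul_scalar_mx.
by rewrite ME CE linearZ /= -scalemxAl.
Qed.

Lemma quadratic_three_eigenvalues (a b c : R) :
  (L - a%:M) *m (L - b%:M) = c *: (sqrt_valency^T *m sqrt_valency) ->
  (L - a%:M) *m (L - b%:M) *m L = 0.
Proof.
move=> ->; rewrite -scalemxAl -mulmxA.
by rewrite sqrt_valency_mul_laplacian mulmx0 scaler0.
Qed.

(** * Consequences of non-completeness *)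

(* If (L - a) L = 0, then every row of L - a is a multiple of the positive vector
   sqrt_valency, whereas the row of a vertex with a non-neighbor has a zero
   entry there but a nonzero entry at each neighbor. *)
Lemma noncomplete_laplacian (a : R) :
  connected_graph adj -> ~ complete_graph adj -> (L - a%:M) *m L != 0.
Proof.
move=> conn ncompl; apply/eqP => quad0; apply: ncompl => u v neq_uv.
apply/negPn/negP => nuv.
have [c rowE] : exists c, row (enum_rank u) (L - a%:M) = c *: sqrt_valency.
  by apply: laplacian_kernel => //; rewrite -row_mul quad0 row0.
have entry w : w != u -> - ((adj u w)%:R / (s u * s w)) = c * s w.
  move=> neq_wu; have /rowP/(_ (enum_rank w)) := rowE.
  rewrite normalized_laplacianE !mxE !enum_rankK (inj_eq enum_rank_inj).
  by rewrite eq_sym (negPf neq_wu) sub0r subr0.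
have c0 : c = 0.
  have := entry v; rewrite eq_sym neq_uv (negPf nuv) mul0r oppr0.
  move=> /(_ isT)/esym/eqP; rewrite mulf_eq0 (negPf (sqrtv_neq0 v)) orbF.
  by move/eqP.
have /card_gt0P[w] := valency_gt0 u; rewrite inE => uw.
have neq_wu : w != u by apply: contraTneq uw => ->; rewrite adj_irr.
have /eqP := entry w neq_wu; rewrite uw c0 mul0r oppr_eq0 mulf_eq0 invr_eq0.
by rewrite mulf_eq0 !(negPf (sqrtv_neq0 _)) oner_eq0.
Qed.

(** Otherwise the closed neighborhood of any u would be stable under adjacency, hence all of V by
    connectedness, and the graph would be complete. *)
Lemma noncomplete_common_neighbor :
  connected_graph adj -> ~ complete_graph adj ->
  exists u v w : V, [/\ u != v, ~~ adj u v, adj w u & adj w v].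
Proof.
move=> [_ conn] ncompl.
case: (boolP [exists u, exists v, exists w,
    [&& u != v, ~~ adj u v, adj w u & adj w v]]) => [|none].
  move=> /existsP[u /existsP[v /existsP[w /and4P[]]]].
  by exists u, v, w.
case: ncompl => u v neq_uv.
have closed_u : closed adj [pred w | (w == u) || adj u w].
  apply: intro_closed => [|x y xy]; first exact: sym_connect_sym.
  rewrite !inE => /orP[/eqP<-|ux]; first by rewrite xy orbT.
  case: eqVneq => //= neq_yu; apply: contraNT none => nuy.
  apply/existsP; exists u; apply/existsP; exists y; apply/existsP; exists x.
  by rewrite eq_sym neq_yu nuy adjC ux xy.
have := closed_connect closed_u (conn u v).
by rewrite !inE eqxx eq_sym (negPf neq_uv) => /esym.
Qed.

Lemma common_neighbors_gt0 (u v w : V) :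
  adj w u -> adj w v -> 0 < normalized_common_neighbors R adj u v.
Proof.
move=> wu wv; rewrite /normalized_common_neighbors (bigD1 w) ?wu //=.
apply: ltr_wpDr; last by rewrite divr_gt0 ?valencyr_gt0.
by apply: sumr_ge0 => x _; rewrite divr_ge0 ?ler0n.
Qed.

(* By (iii), theta1 * theta2 = 0 would leave two non-adjacent vertices with no
   common neighbor. *)
Lemma noncomplete_properties_neq0 (a b : R) :
  connected_graph adj -> ~ complete_graph adj ->
  three_eigenvalue_properties adj a b -> (a != 0) && (b != 0).
Proof.
move=> conn ncompl [_ _ nadjE].
have [u [v [w [neq_uv nuv wu wv]]]] := noncomplete_common_neighbor conn ncompl.
have := common_neighbors_gt0 wu wv; rewrite nadjE //.
apply: contraTT; rewrite negb_and !negbK => /orP[]/eqP->.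
  by rewrite !mul0r ltxx.
by rewrite mulr0 !mul0r ltxx.
Qed.

(** * The spectrum and the two implications *)

Lemma eigenvalue_laplacian0 : connected_graph adj -> eigenvalue L 0.
Proof.
move=> conn; apply/eigenvalueP; exists sqrt_valency.
  by rewrite sqrt_valency_mul_laplacian scale0r.
apply: contraTneq (edges_gt0 conn) => s0.
have /matrixP/(_ 0 0) := sqrt_valency_norm.
by rewrite s0 mul0mx !mxE eqxx mulr1n => <-; rewrite ltxx.
Qed.

(** Applied to an eigenvector, the cubic acts as the scalar (x - a)(x - b)x. *)
Lemma eigenvalue_cubic (a b x : R) :
  (L - a%:M) *m (L - b%:M) *m L = 0 -> eigenvalue L x ->
  x \in [:: 0; a; b].
Proof.
move=> cubic /eigenvalueP[v vL v_neq0].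
have vLc c : v *m (L - c%:M) = (x - c) *: v.
  by rewrite mulmxBr vL mul_mx_scalar scalerBl.
have /eqP : v *m ((L - a%:M) *m (L - b%:M) *m L) = 0 by rewrite cubic mulmx0.
rewrite !mulmxA vLc -scalemxAl vLc -!scalemxAl vL !scalerA scaler_eq0.
rewrite (negPf v_neq0) orbF !mulf_eq0 !subr_eq0 !inE.
by case: (x == 0); case: (x == a); case: (x == b).
Qed.

Lemma noncomplete_has_three_L_eigenvalues (a b : R) :
  connected_graph adj -> ~ complete_graph adj ->
  three_eigenvalue_properties adj a b -> has_three_L_eigenvalues adj a b.
Proof.
move=> conn ncompl props.
have /andP[a_neq0 b_neq0] := noncomplete_properties_neq0 conn ncompl props.
have cubic : (L - a%:M) *m (L - b%:M) *m L = 0.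
  exact: (quadratic_three_eigenvalues ((properties_quadratic a b).1 props)).
have nquad c : (L - c%:M) *m L != 0 by exact: noncomplete_laplacian.
(* If a were not an eigenvalue, [L - a] would be invertible and could be cancelled from the cubic,
   against [nquad b]. *)
have eig_a : eigenvalue L a.
  apply: contraNT (nquad b) => /unitmx_not_eigenvalue unit_a.
  by rewrite -(mulKmx unit_a (_ *m L)) [X in _ *m X]mulmxA cubic mulmx0.
have eig_b : eigenvalue L b.
  apply: contraNT (nquad a) => /unitmx_not_eigenvalue unit_b.
  rewrite -(mulKmx unit_b (_ *m L)) [X in _ *m X]mulmxA comm_sub_scalar.
  by rewrite cubic mulmx0.
(* If a = b, the symmetric matrix (L - a) L has square (L - a)(L - a) L L = 0, hence vanishes,
   against [nquad a]. *)
have neq_ab : a != b.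
  apply: contraNneq (nquad a) => eq_ab; rewrite -eq_ab in cubic.
  have comm : L *m (L - a%:M) = (L - a%:M) *m L.
    by rewrite mulmxBl mulmxBr mul_mx_scalar mul_scalar_mx.
  apply/eqP/symmetric_sqr_eq0.
    by rewrite trmx_mul linearB /= tr_scalar_mx normalized_laplacian_tr.
  by rewrite -mulmxA [L *m (_ *m L)]mulmxA comm !mulmxA cubic mul0mx.
split=> [|x].
  by rewrite /= !inE negb_or ![0 == _]eq_sym a_neq0 b_neq0 neq_ab.
apply/idP/idP; first exact: eigenvalue_cubic.
by rewrite !inE => /or3P[]/eqP-> //; exact: eigenvalue_laplacian0.
Qed.

Lemma has_three_L_eigenvalues_properties (a b : R) :
  connected_graph adj -> has_three_L_eigenvalues adj a b ->
  three_eigenvalue_properties adj a b.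
Proof.
move=> conn [_ eigL]; apply/properties_quadratic.
apply: three_eigenvalues_quadratic => //.
(* With 0 listed last, the product ends in the factor L, as in the cubic. *)
have eigL' x : eigenvalue L x -> x \in [:: a; b; 0].
  by rewrite eigL !inE => /or3P[] ->; rewrite ?orbT.
have := symmetric_prod_eigenvalues normalized_laplacian_tr eigL'.
rewrite !big_cons big_nil mulr1 raddf0 subr0 => cubic.
by rewrite -mulmxA.
Qed.

End Graph.

(** In a connected graph a vertex of valency 0 is the only vertex; then L = 0, which leaves no room
    for the nonzero eigenvalue a. *)
Lemma has_three_L_eigenvalues_valency_gt0 (R : rcfType) (V : finType)
    (adj : rel V) (a b : R) :
  symmetric adj -> connected_graph adj -> has_three_L_eigenvalues adj a b ->
  forall u, (0 < valency adj u)%N.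
Proof.
move=> adjC conn [/= /and3P[] + _ _ eigL] u; rewrite inE negb_or.
case/andP=> a_neq0 _; rewrite lt0n; apply: contraNneq a_neq0 => val0.
have all_u v : v = u.
  apply/eqP; apply: contraTT isT; rewrite eq_sym => neq_uv.
  by have := connected_valency_gt0 adjC conn neq_uv; rewrite val0.
have L0 : normalized_laplacian R adj = 0.
  by apply/matrixP => i j; rewrite !mxE /= !(all_u (enum_val _)) eqxx val0.
have : eigenvalue (normalized_laplacian R adj) a by rewrite eigL !inE eqxx orbT.
case/eigenvalueP=> v; rewrite L0 mulmx0 => /esym/eqP.
by rewrite scaler_eq0 eq_sym => /orP[//|/eqP->]; rewrite eqxx.
Qed.

Theorem theorem1 (R : rcfType) (V : finType) (adj : rel V)
    (simple_adj : simple_graph adj) (connected_adj : connected_graph adj)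
    (theta1 theta2 : R) :
  (has_three_L_eigenvalues adj theta1 theta2 ->
     three_eigenvalue_properties adj theta1 theta2) /\
  (~ complete_graph adj ->
     three_eigenvalue_properties adj theta1 theta2 ->
     has_three_L_eigenvalues adj theta1 theta2).
Proof.
have [adjC adj_irr] := simple_adj.
split=> [three|ncompl].
  have valency_gt0 :=
    has_three_L_eigenvalues_valency_gt0 adjC connected_adj three.
  exact: has_three_L_eigenvalues_properties.
apply: noncomplete_has_three_L_eigenvalues => // u.
(* A graph whose only vertex is u is vacuously complete, so a second vertex exists. *)
case: (boolP [forall v, u == v]) => [/forallP all_u|].
  case: ncompl => x y /negP[].
  by rewrite -(eqP (all_u x)) all_u.
rewrite negb_forall => /existsP[v neq_uv].
exact: connected_valency_gt0 neq_uv.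
Qed.
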